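(* Let $A\in\mathcal{M}_n(\mathbb{C})$ be a normal matrix having the eigenvalues $a_1,\dots,a_n$ (listed with algebraic multiplicity) and let $C\in\mathcal{M}_n(\mathbb{C})$ be a Hermitian matrix such that $AC=CA$. Consider the continuous Lyapunov equation $$(E)\qquad A^{\star}X+XA=C$$ with unknown $X\in\mathcal{M}_n(\mathbb{C})$, and let $\widehat{X}=(A+A^\star)^{\mathbf{D}}C$. The following statements hold. (i) $\widehat{X}=(A+A^\star)^{\mathbf{D}}C=(A+A^\star)^{\dagger}C$ is a Hermitian matrix that commutes with all the matrices in the set $\{A,A^\star,C\}$. (ii) Any of the following conditions is a necessary and sufficient condition for the consistency of $(E)$: (a) $\widehat{X}$ is a solution of $(E)$; (b) the standard linear equation $(A+A^\star)X=C$ is consistent; (c) $\widehat{X}$ is a solution of the standard linear equation $(A+A^\star)X=C$. (iii) If $(E)$ is consistent, then the dimension of the affine set of its solutions is equal to the cardinality of $\{(r,s)\in\{1,\dots,n\}^2\mid\overline{a}_r+a_s=0\}$. (iv) If $(E)$ is consistent, then the following statements are equivalent: (a) all solutions of $(E)$ are normal matrices; (b) if $r,s\in\{1,\dots,n\}$ and $r\neq s$, then $\overline{a}_r+a_s\neq 0$. (v) If $A+A^\star$ is invertible, then $\widehat{X}=(A+A^\star)^{-1}C$ is a solution of $(E)$. In addition, if $X\neq\widehat{X}$ is a solution of $(E)$, then $AX\neq XA$ and $A^\star X\neq XA^\star$. (vi) If $(E)$ is consistent and $A+A^\star$ is not invertible, then $(E)$ has an infinite number of solutions.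
   Context: $\mathcal{M}_n(\mathbb{C})$ is the set of complex $n\times n$ matrices; $M^\star$ is the conjugate transpose of $M$; $M$ is normal if $MM^\star=M^\star M$ and Hermitian if $M=M^\star$. An equation is consistent if it has at least one solution. $M^{\dagger}$ denotes the Moore–Penrose inverse. The Drazin inverse $M^{\mathbf{D}}$ of $M\in\mathcal{M}_n(\mathbb{C})$ is the unique matrix with $M^{p+1}M^{\mathbf{D}}=M^{p}$, $M^{\mathbf{D}}MM^{\mathbf{D}}=M^{\mathbf{D}}$, $M^{\mathbf{D}}M=MM^{\mathbf{D}}$, where $p=\mathrm{ind}(M)$ is the least nonnegative integer with $\mathrm{rank}(M^{p+1})=\mathrm{rank}(M^p)$. *)

(* Defs.v *)
From HB Require Import structures.
From mathcomp Require Import all_boot all_order all_algebra.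
From mathcomp Require Import boolp classical_sets cardinality reals.
From mathcomp Require Import complex.

Set Implicit Arguments.
Unset Strict Implicit.
Unset Printing Implicit Defensive.

Import Order.TTheory GRing.Theory Num.Theory.

Local Open Scope ring_scope.
Local Open Scope sesquilinear_scope.

Section Drazin.
Variables (F : fieldType) (n : nat).
Implicit Types M D : 'M[F]_n.

Lemma mxindex_ex M : exists p, \rank (M ^+ p.+1) == \rank (M ^+ p).
Proof.
suff H k : (exists p, \rank (M ^+ p.+1) == \rank (M ^+ p)) \/
           (\rank (M ^+ k) + k <= n)%N.
  case: (H n.+1) => // le_n; exfalso.
  by move: (leq_trans (leq_addl _ _) le_n); rewrite ltnn.
elim: k => [|k [IH|IH]]; [by right; rewrite addn0 rank_leq_row|by left|].
have [eqk|neqk] := eqVneq (\rank (M ^+ k.+1)) (\rank (M ^+ k)).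
  by left; exists k; apply/eqP.
right; rewrite addnS -addSn; apply: leq_trans IH; rewrite leq_add2r.
by rewrite ltn_neqAle neqk exprS mxrankM_maxr.
Qed.

Definition mxindex M : nat := ex_minn (mxindex_ex M).

Definition is_drazin M D : bool :=
  [&& M ^+ (mxindex M).+1 *m D == M ^+ mxindex M,
      D *m M *m D == D & D *m M == M *m D].

Lemma mxexp_stable M k : (M ^+ mxindex M <= M ^+ (mxindex M + k))%MS.
Proof.
rewrite /mxindex; case: ex_minnP => p /eqP rkp _.
have lep : (M ^+ p <= M ^+ p.+1)%MS.
  have sub : (M ^+ p.+1 <= M ^+ p)%MS by rewrite exprS submxMl.
  by have [_ <-] := mxrank_leqif_sup sub; rewrite rkp.
elim: k => [|k IH]; first by rewrite addn0 submx_refl.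
by rewrite addnS exprSr (submx_trans lep) // exprSr submxMr.
Qed.

Lemma trmx_exp M p : M^T ^+ p = (M ^+ p)^T.
Proof.
elim: p => [|p IH]; first by rewrite !expr0 trmx1.
by rewrite exprSr exprS IH trmx_mul.
Qed.

Lemma mxindex_tr M : mxindex M^T = mxindex M.
Proof.
rewrite /mxindex; case: ex_minnP => p; case: ex_minnP => q.
rewrite !trmx_exp !mxrank_tr => rq minq rp minp.
by apply/eqP; rewrite eqn_leq minq // minp // !trmx_exp !mxrank_tr.
Qed.

Lemma drazin_ex M : exists D, is_drazin M D.
Proof.
rewrite /is_drazin; set p := mxindex M; pose G := M ^+ (p + p.+1).
have [E defE] : exists E, M ^+ p = E * G by apply/submxP/mxexp_stable.
have [K defK] : exists K, M ^+ p = G * K.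
  have /submxP [K] := mxexp_stable M^T p.+1.
  rewrite mxindex_tr -/p !trmx_exp => /(congr1 trmx).
  by rewrite trmx_mul !trmxK => ->; exists K^T.
pose D := M ^+ p * pinvmx G * M ^+ p.
have GQG : G * pinvmx G * G = G by apply: mulmxKpV.
have DE : D = E * G * K.
  have -> : D = (E * G) * pinvmx G * (G * K) by rewrite -defE -defK.
  by rewrite -[in RHS]GQG !mulrA.
have DK : D = M ^+ p * K by rewrite DE -defE.
have DE2 : D = E * M ^+ p by rewrite DE -mulrA -defK.
have GM : G * M = M * G by rewrite -exprS -exprSr.
have comm : D * M = M * D.
  rewrite {1}DE2 DK -mulrA -exprSr exprS mulrA.
  transitivity (E * M * G * K); first by rewrite defK !mulrA.
  by rewrite mulrA -exprS exprSr defE -[E * M * G]mulrA -GM !mulrA.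
exists D; apply/and3P; split; apply/eqP => //.
- by rewrite -[_ *m _]/(_ * _) DK mulrA -exprD addSnnS -/G -defK.
- change (D * M * D = D); rewrite -mulrA {2}DK.
  have MK : M ^+ p * (M * (M ^+ p * K)) = M ^+ p.
    by rewrite [M * _]mulrA -exprS mulrA -exprD -/G -defK.
  by rewrite /D -[_ * _ * M ^+ p * _]mulrA MK.
Qed.

Lemma drazin_uniq M D1 D2 : is_drazin M D1 -> is_drazin M D2 -> D1 = D2.
Proof.
rewrite /is_drazin; set p := mxindex M.
move=> /and3P[/eqP a1 /eqP b1 /eqP c1] /and3P[/eqP a2 /eqP b2 /eqP c2].
have L D k : D *m M *m D = D -> D *m M = M *m D -> D = D ^+ k.+1 * M ^+ k.
  move=> b c; elim: k => [|k IH]; first by rewrite expr0 mulr1.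
  have {1}-> : D = D * D * M by rewrite -mulrA [D * M]c mulrA [D * M * D]b.
  rewrite {2}IH mulrA -exprS -mulrA -exprSr.
  by [].
have R D k : D *m M *m D = D -> D *m M = M *m D -> D = M ^+ k * D ^+ k.+1.
  move=> b c; rewrite {1}(L D k b c).
  by apply: commrX; apply/commr_sym/commrX.
transitivity (D1 * M * D2).
- rewrite {1}(L D1 p b1 c1) -a2 -[_ *m D2]/(_ * D2) (exprSr M) !mulrA.
  by rewrite -(L D1 p b1 c1).
- rewrite [RHS](R D2 p b2 c2).
  have {1}<- : M ^+ p.+1 * D1 = M ^+ p := a1.
  have -> : M ^+ p.+1 * D1 = D1 * M * M ^+ p.
    by rewrite -mulrA -exprS; apply/commr_sym/commrX.
  by rewrite -[RHS]mulrA -(R D2 p b2 c2).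
Qed.

(* [is_drazin M] has exactly one solution (drazin_ex, drazin_uniq), so the
   choice below is not arbitrary; likewise for [mpinv]. *)
Definition drazin M : 'M[F]_n := xchoose (drazin_ex M).

Lemma drazinP M : is_drazin M (drazin M).
Proof. exact: xchooseP. Qed.

End Drazin.

Section MoorePenrose.
Variables (C : numClosedFieldType) (m n : nat).
Implicit Types (M : 'M[C]_(m, n)) (P : 'M[C]_(n, m)).

Definition is_mpinv M P : bool :=
  [&& M *m P *m M == M, P *m M *m P == P,
      M *m P \is hermsymmx & P *m M \is hermsymmx].

Lemma hermP k (H : 'M[C]_k) : reflect (H^t* = H) (H \is hermsymmx).
Proof.
apply: (iffP (is_hermitianmxP _ _ _)); rewrite expr0 scale1r.
  by move=> {2}->.
by move=> ->.
Qed.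

Lemma ctrmxM a b c (A : 'M[C]_(a, b)) (B : 'M[C]_(b, c)) :
  (A *m B)^t* = B^t* *m A^t*.
Proof. by rewrite trmx_mul map_mxM. Qed.

Lemma mulmx_ctr_eq0 a b (A : 'M[C]_(a, b)) : A *m A^t* = 0 -> A = 0.
Proof.
move=> A0; apply/matrixP => i j; rewrite mxE.
have := congr1 (fun B : 'M_a => B i i) A0; rewrite !mxE.
move=> S0; have S0' : \sum_k `|A i k| ^+ 2 = 0.
  by rewrite -[RHS]S0; apply: eq_bigr => k _; rewrite !mxE normCK.
have /(_ j isT)/eqP := psumr_eq0P (fun k _ => exprn_ge0 2 (normr_ge0 (A i k))) S0'.
by rewrite expf_eq0 /= normr_eq0 => /eqP.
Qed.

Lemma ctr_sub a b (A : 'M[C]_(a, b)) : exists H, A^t* = H *m A *m A^t*.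
Proof.
suff /submxP[H eH] : (A^t* <= A *m A^t*)%MS by exists H; rewrite -mulmxA.
have [_ <-] := mxrank_leqif_sup (submxMl A (A^t*)); rewrite eqn_leq mxrankM_maxr /=.
have -> : \rank (A^t*) = \rank A by rewrite mxrank_map mxrank_tr.
have kz : kermx (A *m A^t*) *m A = 0.
  apply: mulmx_ctr_eq0.
  by rewrite ctrmxM mulmxA -[_ *m A *m _]mulmxA mulmx_ker mul0mx.
have /mxrankS : (kermx (A *m A^t*) <= kermx A)%MS by apply/sub_kermxP.
by rewrite !mxrank_ker leq_sub2lE // rank_leq_row.
Qed.

Lemma mpinv_ex M : exists P, is_mpinv M P.
Proof.
pose G := M^t* *m M *m M^t*.
have [H defH] := ctr_sub M; have [K] := ctr_sub (M^t*); rewrite trmxCK => defK.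
have defE : M^t* = (H *m K) *m G.
  by rewrite {1}defH {1}defK /G !mulmxA.
have defH' : M = M *m M^t* *m H^t*.
  by have /(congr1 (fun B => B^t*)) := defH; rewrite !ctrmxM trmxCK mulmxA.
have defK' : M^t* = M^t* *m M *m K^t*.
  by have /(congr1 (fun B => B^t*)) := defK; rewrite !ctrmxM trmxCK mulmxA.
have defF : M^t* = G *m (H^t* *m K^t*).
  have -> : G *m (H^t* *m K^t*) = M^t* *m (M *m M^t* *m H^t*) *m K^t*.
    by rewrite /G !mulmxA.
  by rewrite -defH' -defK'.
have GQG : G *m pinvmx G *m G = G by apply: mulmxKpV.
pose P := M^t* *m pinvmx G *m M^t*.
have PMM : M^t* = P *m M *m M^t*.
  have -> : P *m M *m M^t* = M^t* *m pinvmx G *m G by rewrite /P /G !mulmxA.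
  by have := congr1 (mulmx (H *m K)) GQG; rewrite 2!mulmxA -defE.
have MMP : M^t* = M^t* *m M *m P.
  have -> : M^t* *m M *m P = G *m pinvmx G *m M^t* by rewrite /P /G !mulmxA.
  by have := congr1 (mulmxr (H^t* *m K^t*)) GQG; rewrite /= -mulmxA -defF.
have MP : M = (M *m P)^t* *m M.
  have /(congr1 (fun B => B^t*)) e := MMP.
  by rewrite -mulmxA [RHS]ctrmxM !trmxCK in e.
have PM : M = M *m (P *m M)^t*.
  have /(congr1 (fun B => B^t*)) e := PMM.
  by rewrite [RHS]ctrmxM !trmxCK in e.
have herm k (B : 'M[C]_k) : B = B^t* *m B -> B^t* = B.
  by move=> e; rewrite e ctrmxM trmxCK -e.
have herm' k (B : 'M[C]_k) : B = B *m B^t* -> B^t* = B.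
  by move=> e; rewrite e ctrmxM trmxCK -e.
have hMP : (M *m P)^t* = M *m P by apply: herm; rewrite mulmxA -MP.
have hPM : (P *m M)^t* = P *m M.
  by apply: herm'; rewrite -(mulmxA P M) -PM.
exists P; apply/and4P; split; try exact/hermP; apply/eqP.
- by rewrite hMP in MP.
- have -> : P *m M *m P = P *m M *m M^t* *m pinvmx G *m M^t*.
    by rewrite /P !mulmxA.
  by rewrite -PMM.
Qed.

Lemma mpinv_uniq M P1 P2 : is_mpinv M P1 -> is_mpinv M P2 -> P1 = P2.
Proof.
move=> /and4P[/eqP a1 /eqP b1 /hermP c1 /hermP d1].
move=> /and4P[/eqP a2 /eqP b2 /hermP c2 /hermP d2].
transitivity (P1 *m M *m P2).
- have e : M *m P1 = M *m P1 *m (M *m P2).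
    by rewrite -{2}c1 -{1}c2 -ctrmxM mulmxA a2 c1.
  by rewrite -{1}b1 -mulmxA e !mulmxA b1.
- have e : P2 *m M = P1 *m M *m (P2 *m M).
    by rewrite -{1}d1 -{2}d2 -ctrmxM -mulmxA (mulmxA M) a1 d2.
  by rewrite -{2}b2 e -[RHS]mulmxA b2.
Qed.

Definition mpinv M : 'M[C]_(n, m) := xchoose (mpinv_ex M).

Lemma mpinvP M : is_mpinv M (mpinv M).
Proof. exact: xchooseP. Qed.

End MoorePenrose.

Section Equations.
Variables (C : numClosedFieldType) (n : nat).
Implicit Types A B M X : 'M[C]_n.

Definition lyapunov_sols A M : set 'M[C]_n :=
  [set X : 'M[C]_n | A^t* *m X + X *m A = M]%classic.

Definition linear_sols B M : set 'M[C]_n :=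
  [set X : 'M[C]_n | B *m X = M]%classic.

Definition consistent (S : set 'M[C]_n) : Prop := (S !=set0)%classic.

End Equations.

Definition affine_of_dim (F : fieldType) (V : vectType F) (S : set V)
    (d : nat) : Prop :=
  exists (x0 : V) (U : {vspace V}),
    S = [set x0 + u | u in [set u : V | u \in U]]%classic /\ \dim U = d.

(* Main.v *)
Require Import Defs.
From mathcomp Require Import all_boot all_order all_algebra fingroup perm.
From mathcomp Require Import boolp classical_sets cardinality reals.
From mathcomp Require Import complex.

Set Implicit Arguments.
Unset Strict Implicit.
Unset Printing Implicit Defensive.

Import Order.TTheory GRing.Theory Num.Theory.

Local Open Scope ring_scope.
Local Open Scope sesquilinear_scope.

(** The spectral theorem gives a unitary [V] with [V A V^t* = diag a].  In that
    basis the Lyapunov equation decouples entrywise into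
    [(conj a_r + a_s) X_rs = C_rs], and the linear equation [S X = C], where
    [S = A + A^t*], into [(a_r + conj a_r) X_rs = C_rs].  Since [C] commutes with
    [A], [C_rs] is nonzero only when [a_r = a_s], where the two coefficients
    agree; hence both equations are consistent together.  The homogeneous
    solutions are the matrices supported on the pairs with
    [conj a_r + a_s = 0].  As [S] is Hermitian, its Moore-Penrose inverse
    commutes with it and is therefore also its Drazin inverse. *)

(** * Generalized inverses of Hermitian matrices *)

(** Taking conjugate transposes in the Penrose equations of a Hermitian [S] shows that
    [(mpinv S)^t*] satisfies them as well; uniqueness concludes. *)
Lemma hermsymmx_mpinv (K : numClosedFieldType) (n : nat) (S : 'M[K]_n) :
  S \is hermsymmx -> mpinv S \is hermsymmx.
Proof.
move=> /hermP hS; apply/hermP; apply: (@mpinv_uniq _ _ _ S); last exact: mpinvP.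
have /and4P[/eqP e1 /eqP e2 /hermP e3 /hermP e4] := mpinvP S.
set P := mpinv S in e1 e2 e3 e4 *.
have SP : S *m P^t* = P *m S by rewrite -e4 ctrmxM hS.
have PS : P^t* *m S = S *m P by rewrite -e3 ctrmxM hS.
apply/and4P; split; rewrite ?SP ?PS; try exact/hermP; apply/eqP.
- by rewrite -{1}e4 -[X in _ *m X]hS -ctrmxM mulmxA e1 hS.
- by rewrite -e3 -ctrmxM mulmxA e2.
Qed.

Lemma hermsymmx_mpinvC (K : numClosedFieldType) (n : nat) (S : 'M[K]_n) :
  S \is hermsymmx -> S *m mpinv S = mpinv S *m S.
Proof.
move=> hS; have /hermP hP := hermsymmx_mpinv hS; move/hermP: hS => hS.
have /and4P[_ _ /hermP e3 _] := mpinvP S.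
by rewrite -e3 ctrmxM hP hS.
Qed.

Lemma drazin_hermsymmx (K : numClosedFieldType) (n : nat) (S : 'M[K]_n) :
  S \is hermsymmx -> drazin S = mpinv S.
Proof.
move=> hS; apply: (@drazin_uniq _ _ S); first exact: drazinP.
have comm := hermsymmx_mpinvC hS.
have /and4P[/eqP e1 /eqP e2 _ _] := mpinvP S.
apply/and3P; split; try exact/eqP.
(* For positive index, [S P S = S] and commutation suffice. Index 0 means that [S] has full rank, so
   [S] can be cancelled. *)
apply/eqP; rewrite /mxindex; case: ex_minnP => -[|p] rkp _; last first.
  by rewrite !exprSr -!mulmxE -!mulmxA comm (mulmxA S) e1.
move: rkp; rewrite expr0 expr1 mxrank1 => rkS.
have uS : S \in unitmx by rewrite -row_free_unit.
by apply: (can_inj (mulmxK uS)); rewrite e1 mul1mx.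
Qed.

(** With [P = mpinv S], the projection [P S = S P] commutes with [B], since [P S B] and [B P S] both
    equal [P S B P S]. Then [P B = P P S B = P B S P = P S B P = B P S P = B P]. *)
Lemma mpinv_comm (K : numClosedFieldType) (n : nat) (S B : 'M[K]_n) :
  S \is hermsymmx -> S *m B = B *m S -> mpinv S *m B = B *m mpinv S.
Proof.
move=> hS SB; have comm := hermsymmx_mpinvC hS.
have /and4P[/eqP e1 /eqP e2 _ _] := mpinvP S.
set P := mpinv S in comm e1 e2 *.
have SSP : S *m S *m P = S by rewrite -mulmxA comm mulmxA e1.
have PSS : P *m S *m S = S by rewrite -comm e1.
have PSP : P *m (P *m S) = P by rewrite -comm mulmxA.
have BPS : P *m S *m B = B *m (P *m S).
  transitivity (P *m S *m B *m (P *m S)).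
    transitivity (P *m (B *m (S *m S *m P))); first by rewrite SSP -SB mulmxA.
    have -> : P *m S *m B *m (P *m S) = P *m (S *m B) *m (S *m P).
      by rewrite comm !mulmxA.
    by rewrite SB !mulmxA.
  transitivity (P *m S *m S *m B *m P).
    by rewrite -comm -(mulmxA _ S B) SB !mulmxA.
  by rewrite PSS SB -mulmxA comm.
transitivity (P *m (P *m S *m B)); first by rewrite mulmxA PSP.
by rewrite BPS -comm (mulmxA B) -SB !mulmxA BPS -mulmxA e2.
Qed.

(** * Spectral form with prescribed eigenvalue order *)

Lemma char_poly_unitary_conj (K : numClosedFieldType) (n : nat)
    (V A : 'M[K]_n) :
  V \is unitarymx -> char_poly (V^t* *m A *m V) = char_poly A.
Proof.
move=> uV; have VV : V^t* *m V = 1%:M by apply/mulmx1C/unitarymxP.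
pose lift := @map_mx K {poly K} polyC n n.
have VVl : lift (V^t*) *m lift V = 1%:M by rewrite -map_mxM VV map_mx1.
rewrite /char_poly.
have -> : char_poly_mx (V^t* *m A *m V)
          = lift (V^t*) *m char_poly_mx A *m lift V.
  rewrite /char_poly_mx mulmxBr mulmxBl !map_mxM; congr (_ - _).
  by rewrite scalar_mxC -mulmxA VVl mulmx1.
by rewrite !det_mulmx mulrAC -det_mulmx VVl det1 mul1r.
Qed.

(** The spectral theorem lists the eigenvalues in an order of its own. Comparing the linear factors
    of [char_poly A] gives a permutation onto [a], which is absorbed into the rows of [V]. *)
Lemma normalmx_spectral (K : numClosedFieldType) (n : nat) (A : 'M[K]_n)
    (a : 'I_n -> K) :
  A \is normalmx -> char_poly A = \prod_(r < n) ('X - (a r)%:P) ->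
  exists2 V : 'M[K]_n, V \is unitarymx
    & A = V^t* *m diag_mx (\row_r a r) *m V.
Proof.
move=> /orthomx_spectralP; set V := spectralmx A; set d := spectral_diag A.
have uV : V \is unitarymx by exact: spectral_unitarymx.
rewrite invmx_unitary // => defA.
rewrite {1}defA char_poly_unitary_conj // char_poly_trig; last first.
  exact/diag_mx_is_trig.
move=> ed.
have /tuple_permP[s es] : perm_eq [tuple d 0 i | i < n] [tuple a i | i < n].
  apply: prod_XsubC_eq; rewrite !big_tuple.
  transitivity (\prod_(r < n) ('X - (a r)%:P)); last first.
    by apply: eq_bigr => r _; rewrite tnth_mktuple.
  by rewrite -ed; apply: eq_bigr => r _; rewrite tnth_mktuple !mxE eqxx.
have ds i : d 0 i = a (s i).
  have /val_inj/(congr1 (fun t => tnth t i)) := es.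
  by rewrite !tnth_mktuple.
(* As [d 0 i = a (s i)], the row belonging to [a r] is row [s^-1 r] of [V]. *)
exists (row_perm (s^-1)%g V).
  apply/unitarymxP/matrixP => i j.
  have /matrixP/(_ ((s^-1)%g i) ((s^-1)%g j)) := unitarymxP uV.
  rewrite !mxE (inj_eq perm_inj) => <-.
  by apply: eq_bigr => k _; rewrite !mxE.
rewrite defA; apply/matrixP => i j; rewrite !mul_mx_diag !mxE.
rewrite [RHS](reindex_inj (@perm_inj _ s)); apply: eq_bigr => k _.
by rewrite !mxE permK ds.
Qed.

Lemma ctrmxE (K : numClosedFieldType) (m n : nat) (M : 'M[K]_(m, n)) r s :
  (M^t*) r s = (M s r)^*.
Proof. by rewrite !mxE. Qed.

(** * Unitary change of basis *)

Section UnitaryConjugation.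
Variables (K : numClosedFieldType) (n : nat) (V : 'M[K]_n).
Hypothesis uV : V \is unitarymx.
Implicit Types X Y : 'M[K]_n.

Definition uconj X := V *m X *m V^t*.

Lemma uconj_inj : injective uconj.
Proof.
have uVt : V^t* \is unitarymx by rewrite trmxC_unitary.
apply: (can_inj (g := fun X => V^t* *m X *m V)) => X.
by rewrite /uconj !mulmxA !mulmxKtV // (mulmx1C (unitarymxP uV)) mul1mx.
Qed.

Lemma uconjK X : uconj (V^t* *m X *m V) = X.
Proof. by rewrite /uconj !mulmxA (unitarymxP uV) mul1mx mulmxtVK. Qed.

Lemma uconjD X Y : uconj (X + Y) = uconj X + uconj Y.
Proof. by rewrite /uconj mulmxDr mulmxDl. Qed.

Lemma uconjM X Y : uconj (X *m Y) = uconj X *m uconj Y.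
Proof. by rewrite /uconj !mulmxA mulmxKtV. Qed.

Lemma uconj_ctr X : uconj (X^t*) = (uconj X)^t*.
Proof. by rewrite /uconj !ctrmxM trmxCK mulmxA. Qed.

Lemma uconj_hermsymmx X : (uconj X \is hermsymmx) = (X \is hermsymmx).
Proof.
by apply/hermP/hermP; rewrite -uconj_ctr; [exact: uconj_inj|move=> ->].
Qed.

Lemma uconj_normalmx X : (uconj X \is normalmx) = (X \is normalmx).
Proof.
apply/normalmxP/normalmxP; rewrite -uconj_ctr -!uconjM //.
  exact: uconj_inj.
by move=> ->.
Qed.

Lemma uconj0 : uconj 0 = 0.
Proof. by rewrite /uconj mulmx0 mul0mx. Qed.

End UnitaryConjugation.

(** * The Lyapunov equation in an eigenbasis *)

Section Lyapunov.
Variables (K : numClosedFieldType) (n : nat) (V A : 'M[K]_n) (a : 'I_n -> K).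
Hypothesis uV : V \is unitarymx.
Hypothesis defA : A = V^t* *m diag_mx (\row_r a r) *m V.
Implicit Types X C : 'M[K]_n.

Let uconjA : uconj V A = diag_mx (\row_r a r).
Proof. by rewrite defA uconjK. Qed.

Lemma uconj_mulA X r s : uconj V (A *m X) r s = a r * uconj V X r s.
Proof. by rewrite uconjM // uconjA mul_diag_mx !mxE. Qed.

Lemma uconj_mulAr X r s : uconj V (X *m A) r s = uconj V X r s * a s.
Proof. by rewrite uconjM // uconjA mul_mx_diag !mxE. Qed.

Lemma uconj_mulAt X r s : uconj V (A^t* *m X) r s = (a r)^* * uconj V X r s.
Proof.
by rewrite uconjM // uconj_ctr uconjA tr_diag_mx map_diag_mx mul_diag_mx !mxE.
Qed.

Lemma uconj_lyapunov X r s :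
  uconj V (A^t* *m X + X *m A) r s = ((a r)^* + a s) * uconj V X r s.
Proof.
by rewrite uconjD mxE uconj_mulAt uconj_mulAr mulrDl (mulrC _ (a s)).
Qed.

Lemma lyapunov_solsP C X :
  lyapunov_sols A C X <->
  forall r s, ((a r)^* + a s) * uconj V X r s = uconj V C r s.
Proof.
split=> [<- r s|eX]; first by rewrite uconj_lyapunov.
by apply: (uconj_inj uV); apply/matrixP => r s; rewrite uconj_lyapunov eX.
Qed.

Lemma uconj_linear X r s :
  uconj V ((A + A^t*) *m X) r s = (a r + (a r)^*) * uconj V X r s.
Proof. by rewrite mulmxDl uconjD mxE uconj_mulA uconj_mulAt mulrDl. Qed.

Lemma linear_solsP C X :
  linear_sols (A + A^t*) C X <->
  forall r s, (a r + (a r)^*) * uconj V X r s = uconj V C r s.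
Proof.
split=> [<- r s|eX]; first by rewrite uconj_linear.
by apply: (uconj_inj uV); apply/matrixP => r s; rewrite uconj_linear eX.
Qed.

Lemma comm_uconj_eq C r s :
  A *m C = C *m A -> uconj V C r s != 0 -> a r = a s.
Proof.
move=> cAC; have := uconj_mulA C r s; rewrite cAC uconj_mulAr mulrC => e nz.
by apply/(mulIf nz).
Qed.

Lemma lyapunov_linear_consistent C :
  A *m C = C *m A -> consistent (lyapunov_sols A C) ->
  consistent (linear_sols (A + A^t*) C).
Proof.
move=> cAC [X /lyapunov_solsP eX].
(* Inverting 0 gives 0, which is harmless: if [C_rs] is nonzero, then [a r = a s], and solvability
   of the Lyapunov equation makes the denominator nonzero. *)
pose Y := \matrix_(r, s) ((a r + (a r)^*)^-1 * uconj V C r s).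
exists (V^t* *m Y *m V); apply/linear_solsP => r s; rewrite uconjK // mxE.
have [C0|nzC] := eqVneq (uconj V C r s) 0; first by rewrite C0 !mulr0.
rewrite mulVKf //; apply: contra (nzC) => /eqP d0.
by rewrite -eX -(comm_uconj_eq cAC nzC) addrC d0 mul0r.
Qed.

(** * Structure of the solution set: dimension, normality, infinitude *)

Lemma lyapunov_sols_translate C X0 :
  lyapunov_sols A C X0 ->
  lyapunov_sols A C
    = [set X0 + u | u in [set u : 'M[K]_n | lyapunov_sols A 0 u]]%classic.
Proof.
move=> e0; rewrite /lyapunov_sols; apply/seteqP.
split=> [X /= eX|X /= [Y eY <-]].
  exists (X - X0); last by rewrite addrC subrK.
  rewrite /= mulmxBr mulmxBl addrACA -opprD [A^t* *m X + _]eX.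
  by rewrite [A^t* *m X0 + _]e0 subrr.
by rewrite mulmxDr mulmxDl addrACA eY addr0.
Qed.

Definition resonant := [pred rs : 'I_n * 'I_n | (a rs.1)^* + a rs.2 == 0].

(** Indexed by an arbitrary list of pairs so that freeness can be proved by induction on the
    list. *)
Definition eigen_matrices (s : seq ('I_n * 'I_n)) : seq 'M[K]_n :=
  [seq V^t* *m delta_mx rs.1 rs.2 *m V | rs <- s].

Definition lyapunov_kernel : {vspace 'M[K]_n} :=
  <<eigen_matrices (enum resonant)>>%VS.

Lemma lyapunov_delta r s :
  (a r)^* + a s = 0 -> lyapunov_sols A 0 (V^t* *m delta_mx r s *m V).
Proof.
move=> d0; apply/lyapunov_solsP => i j; rewrite uconjK // uconj0 !mxE.
by case: eqVneq => [->|_]; case: eqVneq => [->|_]; rewrite ?d0 ?mul0r ?mulr0.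
Qed.

(** The matrices [V^t* E_rs V] span the whole space, with the entries of [uconj V X] as the
    coordinates of [X]; for a homogeneous solution the coordinates at nonresonant pairs vanish. *)
Lemma mem_lyapunov_kernel X : X \in lyapunov_kernel <-> lyapunov_sols A 0 X.
Proof.
split=> [/(coord_span (X := in_tuple _))|/lyapunov_solsP eX].
  set g := in_tuple _ => ->; apply: big_ind => [|Y Z eY eZ|i _].
  - by rewrite /lyapunov_sols /= mulmx0 mul0mx addr0.
  - by rewrite /lyapunov_sols /= mulmxDr mulmxDl addrACA [_ + Y *m A]eY add0r.
  have /mapP[[r s]] := mem_nth 0 (ltn_ord i : i < size (tval g))%N.
  rewrite mem_enum => /eqP /= /lyapunov_delta e0 eg.
  rewrite /lyapunov_sols /= -scalemxAr -scalemxAl -scalerDr eg.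
  by rewrite [_ + _]e0 scaler0.
have -> : X = \sum_(r < n) \sum_(s < n)
    uconj V X r s *: (V^t* *m delta_mx r s *m V).
  apply: (uconj_inj uV); rewrite [LHS]matrix_sum_delta /uconj.
  rewrite mulmx_sumr mulmx_suml; apply: eq_bigr => r _.
  rewrite mulmx_sumr mulmx_suml; apply: eq_bigr => s _.
  by rewrite -scalemxAr -scalemxAl -[V *m (_ *m V) *m _]/(uconj V _) uconjK.
apply: rpred_sum => r _; apply: rpred_sum => s _.
have [d0|nz] := eqVneq ((a r)^* + a s) 0.
  apply/rpredZ/memv_span/mapP; exists (r, s) => //.
  by rewrite mem_enum inE /= d0.
have := eX r s; rewrite uconj0 [RHS]mxE => /eqP; rewrite mulf_eq0 (negPf nz) /=.
by move=> /eqP->; rewrite scale0r rpred0.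
Qed.

Lemma uconj_span_delta (s : seq ('I_n * 'I_n)) X i j :
  X \in <<eigen_matrices s>>%VS ->
  (i, j) \notin s -> uconj V X i j = 0.
Proof.
move=> /(coord_span (X := in_tuple _)); set g := in_tuple _ => -> ns.
apply: (big_ind (fun Y => uconj V Y i j = 0)) => [|Y Z eY eZ|k _].
- by rewrite uconj0 mxE.
- by rewrite uconjD mxE eY eZ addr0.
have /mapP[[r t] rt_s ->] := mem_nth 0 (ltn_ord k : k < size (tval g))%N.
rewrite /uconj -scalemxAr -scalemxAl -/(uconj V _) uconjK // !mxE /=.
have [ir|_] := eqVneq i r; last by rewrite mulr0.
have [jt|_] := eqVneq j t; last by rewrite mulr0.
by rewrite ir jt rt_s in ns.
Qed.

Lemma dim_lyapunov_kernel :
  \dim lyapunov_kernel = #|resonant|.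
Proof.
rewrite cardE -(size_map (fun rs => V^t* *m delta_mx rs.1 rs.2 *m V)).
(* Freeness is by definition equality of the dimension of the span and the length. In the induction,
   the new matrix has entry 1 at its own pair, where everything in the span of the others has entry
   0. *)
apply/eqP; rewrite -[_ == _]/(free _).
elim: (enum _) (enum_uniq resonant).
  by rewrite /= nil_free.
move=> [r s] S IH /= /andP[nS uS]; rewrite free_cons IH // andbT.
apply/negP => /uconj_span_delta/(_ nS)/eqP.
by rewrite uconjK // mxE !eqxx oner_eq0.
Qed.

(* Let [Y] be [X] in the eigenbasis.  Then [Y - Y^t*] is diagonal, and its entry
   at [r] can be nonzero only if [a_r + conj a_r = 0], in which case row and
   column [r] of [Y] vanish off the diagonal; so [Y] commutes with [Y - Y^t*]. *)
Lemma normal_lyapunov_sols C X :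
  C \is hermsymmx -> A *m C = C *m A ->
  (forall r s : 'I_n, r != s -> (a r)^* + a s != 0) ->
  lyapunov_sols A C X -> X \is normalmx.
Proof.
move=> hC cAC nres /lyapunov_solsP eX.
rewrite -(uconj_normalmx uV); set Y := uconj V X in eX *.
(* Conjugating the equation at [(s, r)], with [C] Hermitian, shows that [(Y s r)^*] solves the same
   scalar equation as [Y r s]. *)
have dY r s : ((a r)^* + a s) * (Y s r)^* = uconj V C r s.
  move: hC; rewrite -(uconj_hermsymmx uV) => /hermP <-.
  by rewrite ctrmxE -eX rmorphM rmorphD /= conjCK addrC.
have Yherm r s : ((a r)^* + a s != 0) -> (Y s r)^* = Y r s.
  by move=> nz; apply: (mulfI nz); rewrite dY eX.
have Y0 r s : r != s -> (Y r r)^* != Y r r \/ (Y s s)^* != Y s s -> Y r s = 0.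
  move=> neq im; have nz := nres r s neq.
  (* If [C_rs] is nonzero, then [a r = a s], so the coefficients at [(r, r)] and [(s, s)] are
     nonzero too and both diagonal entries are real, against [im]. *)
  have [C0|nzC] := eqVneq (uconj V C r s) 0.
    by apply: (mulfI nz); rewrite eX C0 mulr0.
  move: nz; rewrite -(comm_uconj_eq cAC nzC) => nzr.
  have nzs : (a s)^* + a s != 0 by rewrite -(comm_uconj_eq cAC nzC).
  by case: im => /eqP[]; apply: Yherm.
move: (Y) Yherm Y0 => {eX dY}Y Yherm Y0; pose w := \row_r (Y r r - (Y r r)^*).
have wE r s : diag_mx w r s = (Y r r - (Y r r)^*) *+ (r == s).
  by rewrite [LHS]mxE [in LHS]mxE.
have eYt : Y^t* = Y - diag_mx w.
  apply/matrixP => r s; rewrite ctrmxE [RHS]mxE [X in _ + X]mxE wE.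
  have [<-|neq] := eqVneq r s; first by rewrite mulr1n opprB addrC subrK.
  by rewrite mulr0n subr0 Yherm // nres.
have Yw : Y *m diag_mx w = diag_mx w *m Y.
  rewrite mul_mx_diag mul_diag_mx; apply/matrixP => r s; rewrite 4!mxE.
  have [<-|neq] := eqVneq r s; first by rewrite mulrC.
  have [wr|nr] := eqVneq (Y r r - (Y r r)^*) 0; last first.
    rewrite Y0 ?mulr0 ?mul0r //; left; apply: contra nr => /eqP->.
    by rewrite subrr.
  have [ws|ns] := eqVneq (Y s s - (Y s s)^*) 0; last first.
    rewrite Y0 ?mulr0 ?mul0r //; right; apply: contra ns => /eqP->.
    by rewrite subrr.
  by rewrite wr ws mul0r mulr0.
by apply/normalmxP; rewrite eYt mulmxBr mulmxBl Yw.
Qed.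

(** In a Hermitian matrix, row [r] and column [r] have equal norms. The perturbation turns a 0 of
    row [r] into a 1 and leaves column [r] alone, so the [(r, r)] entries of [M M^t*] and [M^t* M]
    differ by 1. *)
Lemma normalmx_add_delta (Y : 'M[K]_n) (r s : 'I_n) :
  Y \is hermsymmx -> r != s -> Y r s = 0 -> Y + delta_mx r s \isn't normalmx.
Proof.
move=> /hermP hY rs Y0; apply/negP => /normalmxP/matrixP/(_ r r).
have Ysr k : `|Y k r| = `|Y r k| by rewrite -{1}hY ctrmxE norm_conjC.
have eM (M : 'M[K]_n) : (M *m M^t*) r r = \sum_k `|M r k| ^+ 2.
  by rewrite mxE; apply: eq_bigr => k _; rewrite ctrmxE normCK.
have eMt (M : 'M[K]_n) : (M^t* *m M) r r = \sum_k `|M k r| ^+ 2.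
  by rewrite mxE; apply: eq_bigr => k _; rewrite ctrmxE mulrC normCK.
have erow k : (Y + delta_mx r s) r k = Y r k + (k == s)%:R.
  by rewrite !mxE eqxx.
have ecol k : (Y + delta_mx r s) k r = Y k r.
  by rewrite !mxE (negPf rs) andbF addr0.
rewrite eM eMt (bigD1 s) //= [RHS](bigD1 s) //= erow ecol eqxx Ysr Y0 add0r.
rewrite normr0 normr1 expr0n expr1n add0r /=.
under [in LHS]eq_bigr => k /negPf ks do rewrite erow ks addr0 -Ysr.
under [in RHS]eq_bigr => k _ do rewrite ecol.
by move/eqP; rewrite -subr_eq0 addrK oner_eq0.
Qed.

Lemma lyapunov_sols_add C X Y :
  lyapunov_sols A C X -> lyapunov_sols A 0 Y -> lyapunov_sols A C (X + Y).
Proof. by move=> eX eY; rewrite (lyapunov_sols_translate eX); exists Y. Qed.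

(* Having [A + A^t*] as a factor makes [X_rs] vanish in the eigenbasis: [X_rs] can
   be nonzero only if [a_r = a_s], and then its factor [a_r + conj a_r] is 0. *)
Lemma nonnormal_lyapunov_sol C Z r s :
  let X := (A + A^t*) *m Z in
  X \is hermsymmx -> A *m X = X *m A -> lyapunov_sols A C X ->
  r != s -> (a r)^* + a s = 0 ->
  exists2 Y, lyapunov_sols A C Y & Y \isn't normalmx.
Proof.
move=> X hX cAX eX rs d0; exists (X + V^t* *m delta_mx r s *m V).
  exact/lyapunov_sols_add/lyapunov_delta.
rewrite -(uconj_normalmx uV) uconjD uconjK // normalmx_add_delta //.
  by rewrite uconj_hermsymmx.
apply: contraTeq isT => nzX; case/negP: (nzX).
by rewrite uconj_linear addrC {2}(comm_uconj_eq cAX nzX) d0 mul0r.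
Qed.

Lemma infinite_lyapunov_sols C r :
  consistent (lyapunov_sols A C) -> (a r)^* + a r = 0 ->
  infinite_set (lyapunov_sols A C).
Proof.
move=> [X eX] d0 finE; apply: infinite_nat.
(* Natural multiples of one nonzero homogeneous solution; they are distinct in characteristic 0. *)
pose f (k : nat) := X + k%:R *: (V^t* *m delta_mx r r *m V).
have finj : injective f.
  move=> k l /addrI /(congr1 (uconj V)) /matrixP/(_ r r).
  rewrite /uconj -!scalemxAr -!scalemxAl -/(uconj V _) uconjK // !mxE !eqxx.
  by rewrite !mulr1 => /eqP; rewrite eqr_nat => /eqP.
suff -> : [set: nat]%classic = (f @^-1` lyapunov_sols A C)%classic.
  by apply: finite_preimage finE => k l _ _; apply: finj.
apply/esym/seteqP; split => // k _; apply: lyapunov_sols_add => //.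
apply/mem_lyapunov_kernel/rpredZ/mem_lyapunov_kernel.
exact: lyapunov_delta.
Qed.

(** The inverse is diagonal in the eigenbasis. By contraposition, a singular [A + A^t*] yields a
    resonant pair [(r, r)]. *)
Lemma unitmx_add_ctr :
  (forall r, (a r)^* + a r != 0) -> A + A^t* \in unitmx.
Proof.
move=> nz; pose Y := diag_mx (\row_r ((a r)^* + a r)^-1).
suff /mulmx1_unit[] : (A + A^t*) *m (V^t* *m Y *m V) = 1%:M by [].
apply: (uconj_inj uV); apply/matrixP => r s; rewrite uconj_linear uconjK //.
rewrite /uconj mulmx1 (unitarymxP uV) !mxE.
have [_|_] := eqVneq r s; last by rewrite !mulr0n mulr0.
by rewrite !mulr1n addrC mulfV.
Qed.

End Lyapunov.

Theorem theorem3p2 (R : realType) (n : nat) (A C : 'M[R[i]]_n)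
    (a : 'I_n -> R[i])
    (normalA : A \is normalmx)
    (eigA : char_poly A = \prod_(r < n) ('X - (a r)%:P))
    (hermC : C \is hermsymmx)
    (commAC : A *m C = C *m A) :
  let E := lyapunov_sols A C in
  let L := linear_sols (A + A^t*) C in
  let Xhat := drazin (A + A^t*) *m C in
  (* (i) *)
  [/\ Xhat = mpinv (A + A^t*) *m C,
      Xhat \is hermsymmx,
      Xhat *m A = A *m Xhat,
      Xhat *m A^t* = A^t* *m Xhat
    & Xhat *m C = C *m Xhat] /\
  (* (ii) *)
  [/\ consistent E <-> E Xhat,
      consistent E <-> consistent L
    & consistent E <-> L Xhat] /\
  (* (iii) *)
  (consistent E ->
     affine_of_dim E #|[pred rs : 'I_n * 'I_n | (a rs.1)^* + a rs.2 == 0]|) /\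
  (* (iv) *)
  (consistent E ->
     (forall X, E X -> X \is normalmx) <->
     (forall r s : 'I_n, r != s -> (a r)^* + a s != 0)) /\
  (* (v) *)
  (A + A^t* \in unitmx ->
     [/\ Xhat = invmx (A + A^t*) *m C,
         E Xhat
       & forall X, X <> Xhat -> E X ->
           A *m X <> X *m A /\ A^t* *m X <> X *m A^t*]) /\
  (* (vi) *)
  (consistent E -> A + A^t* \notin unitmx -> infinite_set E).
Proof.
move=> E L Xhat.
have [V uV defA] := normalmx_spectral normalA eigA.
set S := A + A^t* in L Xhat *.
have hS : S \is hermsymmx.
  by apply/hermP; rewrite /S linearD /= map_mxD trmxCK addrC.
have AtC : A^t* *m C = C *m A^t*.
  by move/hermP: hermC => {1 2}<-; rewrite -!ctrmxM commAC.
have AAt : A *m A^t* = A^t* *m A by apply/normalmxP.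
have SA : S *m A = A *m S by rewrite mulmxDl mulmxDr AAt.
have SAt : S *m A^t* = A^t* *m S by rewrite mulmxDl mulmxDr AAt.
have SC : S *m C = C *m S by rewrite mulmxDl mulmxDr commAC AtC.
have eP : drazin S = mpinv S by exact: drazin_hermsymmx.
have eX : Xhat = mpinv S *m C by rewrite /Xhat eP.
have PC := mpinv_comm hS SC.
have XA : Xhat *m A = A *m Xhat.
  by rewrite eX -mulmxA -commAC !mulmxA (mpinv_comm hS SA).
have XAt : Xhat *m A^t* = A^t* *m Xhat.
  by rewrite eX -mulmxA -AtC !mulmxA (mpinv_comm hS SAt).
have hX : Xhat \is hermsymmx.
  apply/hermP; rewrite eX ctrmxM (hermP _ hermC).
  by rewrite (hermP _ (hermsymmx_mpinv hS)) PC.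
(* Since [Xhat] commutes with [A], the left-hand sides of the two equations agree at [Xhat]. *)
have LE : L Xhat -> E Xhat.
  by rewrite /L /E /linear_sols /lyapunov_sols /= XA /S mulmxDl addrC.
have conL : consistent L -> L Xhat.
  case=> Y eY; rewrite /L /linear_sols /= eX.
  have /and4P[/eqP e1 _ _ _] := mpinvP S.
  by rewrite -[C in RHS]eY -[C in LHS]eY !mulmxA e1.
have EL : consistent E -> consistent L.
  exact: (lyapunov_linear_consistent uV defA commAC).
have EX : consistent E -> E Xhat by move=> /EL/conL/LE.
split; first by split=> //; rewrite eX mulmxA -PC.
split.
  split; split=> //.
  - by exists Xhat.
  - by move=> /conL/LE eXh; exists Xhat.
  - by move=> /EL/conL.
  - by move=> /LE eXh; exists Xhat.
split.
  move=> /EX e0; exists Xhat, (lyapunov_kernel V a).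
  split; last exact: dim_lyapunov_kernel.
  rewrite [LHS](lyapunov_sols_translate e0); congr (_ @` _)%classic.
  apply/seteqP; split=> X /=.
    by move/(mem_lyapunov_kernel uV defA).
  by move/(mem_lyapunov_kernel uV defA).
split.
  move=> /EX e0; split=> [allN r s rs|nres X].
    apply/eqP => d0.
    (* From [P = P S P]: this exhibits [S] as a left factor of [Xhat], the form needed to perturb it
       into a nonnormal solution. *)
    have eXS : Xhat = S *m (mpinv S *m Xhat).
      have /and4P[_ /eqP e2 _ _] := mpinvP S.
      by rewrite mulmxA (hermsymmx_mpinvC hS) eX mulmxA e2.
    have [] := nonnormal_lyapunov_sol uV defA (C := C) (Z := mpinv S *m Xhat)
      (r := r) (s := s); rewrite -?/S -?eXS // => Y /allN nY.
    by rewrite nY.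
  exact: (normal_lyapunov_sols uV defA hermC commAC).
split.
  move=> uS; have eXi : Xhat = invmx S *m C.
    apply: (can_inj (mulKmx uS)); rewrite mulKVmx //.
    by apply: conL; exists (invmx S *m C); rewrite /L /linear_sols /= mulKVmx.
  split=> //.
    by apply/LE/conL; exists (invmx S *m C); rewrite /L /linear_sols /= mulKVmx.
  (* A solution commuting with [A] satisfies [S X = C], one commuting with [A^t*] satisfies
     [X S = C]; either way it equals [invmx S *m C], because [S] commutes with [C]. *)
  move=> X neX solX; split=> cX; apply: neX; rewrite eXi.
    apply: (can_inj (mulKmx uS)); rewrite mulKVmx // -[RHS]solX.
    by rewrite /S mulmxDl cX addrC.
  have XS : X *m S = C by rewrite -[RHS]solX cX /S mulmxDr addrC.
  rewrite -[LHS](mulmxK uS) XS.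
  by apply: (can_inj (mulKmx uS)); rewrite mulKVmx // mulmxA SC mulmxK.
move=> conE; apply: contraNP => finE; apply: (unitmx_add_ctr uV defA) => r.
apply/eqP => d0; apply: finE.
exact: (infinite_lyapunov_sols uV defA conE d0).
Qed.
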